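(* There exists a constant $c$ such that every unit interval graph $G$ satisfies $$\frac{\chi(G)}{3}\le \chi_1(G)\le \frac{\chi(G)}{3}+c.$$
   Context: All graphs are finite and simple. A 1-selection of a graph $G=(V,E)$ is a map $f$ assigning to each vertex $v$ a set $f(v)$ of at most one edge incident with $v$. The 1-removed subgraph $G_f$ has vertex set $V$ and edge set $E\setminus\bigcup_{v\in V}f(v)$. The robust chromatic number is $\chi_1(G)=\min_f\chi(G_f)$ over all 1-selections $f$. A unit interval graph is a graph whose vertices $v_1,\dots,v_n$ can be labelled by reals $r_1,\dots,r_n$ such that $v_i$ and $v_j$ ($i\neq j$) are adjacent iff $|r_i-r_j|<1$. *)

(* Defs.v *)
From HB Require Import structures.
From mathcomp Require Import all_boot all_order all_algebra.
From mathcomp Require Import reals.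
Set Implicit Arguments.
Unset Strict Implicit.
Unset Printing Implicit Defensive.
Import Order.TTheory GRing.Theory Num.Theory.

Record sgraph := SGraph {
  vertex :> finType;
  adj : rel vertex;
  adj_sym : symmetric adj;
  adj_irr : irreflexive adj }.

Definition edges (G : sgraph) : {set {set G}} :=
  [set [set p.1; p.2] | p : G * G & adj p.1 p.2].

Lemma mem_edges (G : sgraph) (x y : G) : ([set x; y] \in edges G) = adj x y.
Proof.
apply/imsetP/idP => [[[a b]]|xy]; last by exists (x, y); rewrite ?inE.
rewrite inE /= => ab xyab.
have nab : a != b by apply: contraTneq ab => ->; rewrite adj_irr.
have : a \in [set x; y] by rewrite xyab set21.
have : b \in [set x; y] by rewrite xyab set22.
rewrite !inE => /orP[] /eqP eb /orP[] /eqP ea; move: ab nab;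
  rewrite ea eb ?eqxx //; by rewrite adj_sym.
Qed.

Definition proper_colouring (G : sgraph) (k : nat) (c : {ffun G -> 'I_k}) :=
  [forall x, forall y, adj x y ==> (c x != c y)].

Definition colourable (G : sgraph) (k : nat) : bool :=
  [exists c : {ffun G -> 'I_k}, proper_colouring c].

Lemma ex_colourable (G : sgraph) : exists k, colourable G k.
Proof.
exists #|G|; apply/existsP; exists [ffun x => enum_rank x].
apply/forallP => x; apply/forallP => y; apply/implyP => xy; rewrite !ffunE.
by apply: contraTneq xy => /enum_rank_inj ->; rewrite adj_irr.
Qed.

Definition chromatic_number (G : sgraph) : nat := ex_minn (ex_colourable G).

Definition one_selection (G : sgraph) (f : {ffun G -> {set {set G}}}) : bool :=
  [forall v, (#|f v| <= 1) && (f v \subset [set e in edges G | v \in e])].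

Section Removed.
Variables (G : sgraph) (f : {ffun G -> {set {set G}}}).

Definition removed_adj : rel G :=
  fun x y => adj x y && ([set x; y] \notin \bigcup_v f v).

Lemma removed_adj_sym : symmetric removed_adj.
Proof. by move=> x y; rewrite /removed_adj adj_sym setUC. Qed.

Lemma removed_adj_irr : irreflexive removed_adj.
Proof. by move=> x; rewrite /removed_adj adj_irr. Qed.

Definition removed_subgraph : sgraph := SGraph removed_adj_sym removed_adj_irr.

Lemma edges_removed_subgraph :
  edges removed_subgraph = edges G :\: \bigcup_v f v.
Proof.
apply/setP => e; apply/imsetP/setDP => [[[x y]]|[]].
  by rewrite inE /= => /andP[xy nf] ->; rewrite mem_edges.
case/imsetP => -[x y]; rewrite inE /= => xy -> nf.
by exists (x, y); rewrite ?inE //= /removed_adj xy.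
Qed.

End Removed.

Lemma ex_removed_chromatic (G : sgraph) :
  exists k, [exists f : {ffun G -> {set {set G}}},
    one_selection f && (chromatic_number (removed_subgraph f) == k)].
Proof.
exists (chromatic_number (removed_subgraph [ffun _ : G => set0])).
apply/existsP; exists [ffun _ => set0]; rewrite eqxx andbT.
by apply/forallP => v; rewrite ffunE cards0 sub0set.
Qed.

Definition robust_chromatic_number (G : sgraph) : nat :=
  ex_minn (ex_removed_chromatic G).

(* The labelling need not be injective: vertices with equal labels are
   adjacent twins. *)
Definition unit_interval (R : realType) (G : sgraph) : Prop :=
  exists r : G -> R, forall x y : G, x != y ->
    (adj x y <-> (`|r x - r y| < 1)%R).

(* Main.v *)
Require Import Defs.
From mathcomp Require Import all_boot all_order all_algebra.
From mathcomp Require Import reals.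
From mathcomp Require Import zify lra.
Import Order.TTheory GRing.Theory Num.Theory.

(** Lower bound: inside a colour class of [G_f] every edge of [G] was selected
by one of its endpoints, so any [m] vertices of the class span at most [m]
edges.  The class is therefore 2-degenerate, hence 3-colourable, and
[chi(G) <= 3 chi(G_f)] holds for every graph.

Upper bound: order the vertices by their labels.  The vertices between two
adjacent ones form a clique, so the positions of adjacent vertices differ by
less than [k = chi(G)].  Cut the order into blocks of three consecutive vertices
and colour the blocks cyclically with [m] colours, where [3 m >= k + 2].
Vertices of the same colour in different blocks are not adjacent, and the at
most three edges inside a block are removed by letting each vertex select the
edge to its cyclic successor in the block. *)

Lemma chromatic_number_colourable (G : sgraph) :
  colourable G (chromatic_number G).
Proof. by rewrite /chromatic_number; case: ex_minnP. Qed.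

Lemma chromatic_number_le (G : sgraph) (T : finType) (c : G -> T) :
  (forall x y, adj x y -> c x != c y) -> chromatic_number G <= #|T|.
Proof.
move=> cP; rewrite /chromatic_number; case: ex_minnP => k _; apply.
apply/existsP; exists [ffun x => enum_rank (c x)].
apply/forallP => x; apply/forallP => y; apply/implyP => /cP.
by rewrite !ffunE (inj_eq enum_rank_inj).
Qed.

Lemma chromatic_numberP (G : sgraph) :
  exists c : G -> 'I_(chromatic_number G), forall x y, adj x y -> c x != c y.
Proof.
have /existsP[c /forallP cP] := chromatic_number_colourable G.
by exists c => x y; have /forallP/(_ y)/implyP := cP x.
Qed.

(** Greedy colouring: set aside a vertex with at most [d] neighbours in [A], colour the rest by
    induction, and give it one of the [d.+1] colours that those neighbours miss. *)
Lemma degenerate_colouring (T : finType) (e : rel T) (d : nat) :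
  symmetric e -> irreflexive e ->
  (forall A : {set T}, A != set0 ->
     exists2 v, v \in A & #|[set u in A | e v u]| <= d) ->
  exists c : T -> 'I_d.+1, forall x y, e x y -> c x != c y.
Proof.
move=> esym eirr degP.
suff colA (A : {set T}) :
    exists c : T -> 'I_d.+1, {in A &, forall x y, e x y -> c x != c y}.
  by have [c cP] := colA setT; exists c => x y; apply: cP; rewrite inE.
have [n] := ubnP #|A|; elim: n A => // n IHn A leAn.
have [->|A0] := eqVneq A set0; first by exists (fun=> ord0) => x y; rewrite inE.
have [v vA degv] := degP A A0.
have [|c cP] := IHn (A :\ v); first by rewrite (cardsD1 v A) vA in leAn.
have [i iP] : exists i, i \notin c @: [set u in A | e v u].
  apply/existsP; rewrite -negb_forall; apply/negP => /forallP allc.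
  suff : #|'I_d.+1| <= d by rewrite card_ord ltnn.
  apply: leq_trans degv; apply: leq_trans (leq_imset_card c _).
  by rewrite -cardsT subset_leq_card //; apply/subsetP => i _; exact: allc.
have newP u : u \in A -> e v u -> i != c u.
  by move=> uA evu; apply: contraNneq iP => ->; apply: imset_f; rewrite inE uA.
exists (fun x => if x == v then i else c x) => x y xA yA exy.
have [xv|xv] := eqVneq x v; have [yv|yv] := eqVneq y v.
- by move: exy; rewrite xv yv eirr.
- by apply: newP => //; rewrite -xv.
- by rewrite eq_sym; apply: newP => //; rewrite -yv esym.
- by apply: cP; rewrite ?inE ?xv ?yv.
Qed.

(** Here [o] orients the edges with out-degree at most 1, so the degrees inside any [A] sum to at
    most [2 * #|A|] and some vertex has degree at most 2. *)
Lemma sparse_colouring (T : finType) (e o : rel T) :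
  symmetric e -> irreflexive e -> (forall x y, e x y -> o x y || o y x) ->
  (forall x, #|[set y | o x y]| <= 1) ->
  exists c : T -> 'I_3, forall x y, e x y -> c x != c y.
Proof.
move=> esym eirr eo o1; apply: degenerate_colouring => // A A0.
apply/exists_inP; rewrite -[X in is_true X]negbK negb_exists_in.
apply/negP => /forall_inP deg3.
have cardE (p : rel T) x :
    #|[set y in A | p x y]| = \sum_(y in A) (p x y : nat).
  rewrite -sum1_card (big_mkcond (mem [set y in A | p x y])) [RHS]big_mkcond /=.
  by apply: eq_bigr => y _; rewrite inE; case: (y \in A); case: (p x y).
have out : \sum_(x in A) \sum_(y in A) (o x y : nat) <= #|A|.
  rewrite -sum1_card; apply: leq_sum => x _; rewrite -cardE.
  apply: leq_trans (o1 x); apply: subset_leq_card.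
  by apply/subsetP => y; rewrite !inE => /andP[].
(* If all degrees in [A] were at least 3, counting ordered adjacent pairs would give this, which is
   absurd for nonempty [A]. *)
have : 3 * #|A| <= 2 * #|A|.
  apply: (@leq_trans (\sum_(x in A) \sum_(y in A) (e x y : nat))).
    rewrite mulnC -sum_nat_const; apply: leq_sum => x xA.
    by rewrite -cardE ltnNge deg3.
  apply: (@leq_trans (\sum_(x in A) \sum_(y in A) ((o x y : nat) + o y x))).
    apply: leq_sum => x _; apply: leq_sum => y _.
    by have := eo x y; case: (e x y) => // /(_ isT); case: (o x y); case: (o y x).
  under eq_bigr do rewrite big_split.
  rewrite big_split /= [X in _ + X]exchange_big /= addnn -mul2n.
  by rewrite leq_mul2l out orbT.
by rewrite leq_mul2r /= orbF cards_eq0 (negPf A0).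
Qed.

(** A selected edge contains its selector. The swapped [[set y; x]] matches the shape
    [o x y || o y x] of [sparse_colouring]. *)
Lemma selected_edge (G : sgraph) (f : {ffun G -> {set {set G}}}) (x y : G) :
  one_selection f -> [set x; y] \in \bigcup_v f v ->
  ([set x; y] \in f x) || ([set y; x] \in f y).
Proof.
move=> /forallP fP /bigcupP[v _ xyf].
have /andP[_ /subsetP/(_ _ xyf)] := fP v.
rewrite !inE => /andP[_ /orP[]/eqP vE]; rewrite vE in xyf; first by rewrite xyf.
by rewrite [[set y; x]]setUC xyf orbT.
Qed.

Lemma chromatic_number_removed (G : sgraph) (f : {ffun G -> {set {set G}}}) :
  one_selection f ->
  chromatic_number G <= 3 * chromatic_number (removed_subgraph f).
Proof.
move=> fP; have [c cP] := chromatic_numberP (removed_subgraph f).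
(* The edges of [G] inside the colour classes of [c]: all were removed, and a 3-colouring [d] of
   them makes the pair [(d x, c x)] proper on [G]. *)
pose e (x y : G) := adj x y && (c x == c y).
have [||x y|x|d dP] := sparse_colouring G e (fun x y => [set x; y] \in f x).
- by move=> x y; rewrite /e adj_sym eq_sym.
- by move=> x; rewrite /e adj_irr.
- move=> /andP[xy cxy]; apply: selected_edge => //.
  by apply: contraTT cxy => nf; apply: cP; rewrite /= /removed_adj xy.
- have /forallP/(_ x)/andP[fx1 _] := fP.
  apply: leq_trans fx1; rewrite -(@card_in_imset _ _ (fun y => [set x; y])).
    by apply: subset_leq_card; apply/subsetP => E /imsetP[y]; rewrite inE => ? ->.
  move=> y z _ _ xyz.
  have : y \in [set x; z] by rewrite -xyz set22.
  have : z \in [set x; y] by rewrite xyz set22.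
  by rewrite !inE => /orP[]/eqP-> // /orP[]/eqP->.
have -> : 3 * chromatic_number (removed_subgraph f) =
    #|{: 'I_3 * 'I_(chromatic_number (removed_subgraph f))}|.
  by rewrite card_prod !card_ord.
apply: (chromatic_number_le _ _ (fun x => (d x, c x))) => x y xy.
by apply: contraTneq isT => -[dxy cxy]; have := dP x y;
  rewrite /e xy cxy dxy !eqxx => /(_ isT).
Qed.

Lemma robust_chromatic_number_ge (G : sgraph) :
  chromatic_number G <= 3 * robust_chromatic_number G.
Proof.
rewrite /robust_chromatic_number; case: ex_minnP => k + _.
by case/existsP => f /andP[fP /eqP<-]; apply: chromatic_number_removed.
Qed.

Lemma robust_chromatic_number_le (G : sgraph) (f : {ffun G -> {set {set G}}}) :
  one_selection f ->
  robust_chromatic_number G <= chromatic_number (removed_subgraph f).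
Proof.
move=> fP; rewrite /robust_chromatic_number; case: ex_minnP => k _; apply.
by apply/existsP; exists f; rewrite fP eqxx.
Qed.

Lemma robust_chromatic_number_bandwidth (G : sgraph) (s : seq G) (k : nat) :
  (forall x, x \in s) ->
  (forall x y, adj x y -> index y s < index x s + k) ->
  robust_chromatic_number G <= (k + 2) %/ 3 + 1.
Proof.
move=> sP band; rewrite addn1; set m := _.+1.
(* Cyclic successor of a position inside its block of three. *)
pose succ i := i %/ 3 * 3 + (i %% 3).+1 %% 3.
(* In an incomplete last block the default gives [w x = x], which is not adjacent to [x], so nothing
   is selected. *)
pose w x := nth x s (succ (index x s)).
pose f := [ffun x => if adj x (w x) then [set [set x; w x]] else set0].
have fP : one_selection f.
  apply/forallP => x; rewrite ffunE; case: ifP => [xw|_].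
    by rewrite cards1 sub1set inE mem_edges xw set21.
  by rewrite cards0 sub0set.
apply: leq_trans (robust_chromatic_number_le _ _ fP) _.
rewrite -[leqRHS]card_ord.
pose c x : 'I_m := inord (index x s %/ 3 %% m).
apply: (chromatic_number_le (removed_subgraph f) 'I_m c).
have wE x y : index y s = succ (index x s) -> w x = y.
  by move=> xy; rewrite /w -xy nth_index.
have wP x y : removed_adj f x y -> w x != y.
  case/andP=> xy; apply: contraNneq => wx; apply/bigcupP; exists x => //.
  by rewrite ffunE wx xy set11.
move=> x y /= xy; wlog ltxy : x y xy / index x s < index y s.
  have [ltxy|ltyx|/(index_inj x)] := ltngtP (index x s) (index y s).
  - exact.
  - by rewrite eq_sym; apply => //; rewrite removed_adj_sym.
  - move=> /(_ (sP _) (sP _)) exy.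
    by move: xy; rewrite exy removed_adj_irr.
apply/eqP => /(congr1 val); rewrite /= !inordK ?ltn_mod // => cxy.
have nwx : index y s != succ (index x s).
  by apply: contraNneq (wP _ _ xy) => /wE->.
have nwy : index x s != succ (index y s).
  rewrite removed_adj_sym in xy.
  by apply: contraNneq (wP _ _ xy) => /wE->.
have /andP[/band bxy _] := xy.
move: (index x s) (index y s) ltxy cxy nwx nwy bxy => i j ltij cij.
rewrite /succ => nij nji bij.
(* Of two positions in one block, one is always the cyclic successor of the other, which [nij] and
   [nji] exclude. *)
have dij : i %/ 3 < j %/ 3.
  by rewrite ltn_neqAle leq_div2r 1?ltnW // andbT; lia.
(* Distinct block numbers congruent modulo [m] differ by at least [m], so the positions differ by at
   least [3 * m - 2 >= k], against [bij]. *)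
have : i %/ 3 + m <= j %/ 3.
  rewrite -leq_subRL ?(ltnW dij) //; apply: dvdn_leq; rewrite ?subn_gt0 //.
  by rewrite -eqn_mod_dvd 1?ltnW // eq_sym; apply/eqP.
by rewrite /m; lia.
Qed.

Local Open Scope ring_scope.

Lemma unit_interval_bandwidth (R : realType) (G : sgraph) :
  unit_interval R G ->
  exists2 s : seq G, (forall x, x \in s) &
    forall x y, adj x y -> (index y s < index x s + chromatic_number G)%N.
Proof.
case=> r rP; pose le := relpre r (<=%R : rel R).
have le_total : total le by move=> x y; apply: real_leVge; rewrite num_real.
have le_trans' : transitive le by move=> y x z; apply: le_trans.
pose s := sort le (enum G).
have sP x : x \in s by rewrite mem_sort mem_enum.
have us : uniq s by rewrite sort_uniq enum_uniq.
have r_nth x0 i j : (i <= j)%N -> (j < size s)%N ->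
    r (nth x0 s i) <= r (nth x0 s j).
  move=> leij js; apply: (sorted_leq_nth le_trans' _ x0 (sort_sorted _ _)) => //.
    by move=> x; rewrite /le /=.
  by rewrite inE; apply: leq_ltn_trans js.
exists s => // x y xy.
have [c cP] := chromatic_numberP G.
have [ltxy|leyx] := ltnP (index x s) (index y s); last first.
  (* The colour [c x] witnesses that the chromatic number is positive. *)
  by apply: leq_ltn_trans leyx _; rewrite -addn1 leq_add2l; case: (c x) => *; lia.
have xny : x != y by apply: contraTneq xy => ->; rewrite adj_irr.
have ys : (index y s < size s)%N by rewrite index_mem.
have rxy : `|r x - r y| < 1 by apply/rP.
pose z (i : 'I_(index y s - index x s).+1) := nth x s (index x s + i).
have zs (i : 'I_(index y s - index x s).+1) : (index x s + i <= index y s)%N.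
  by have := ltn_ord i; lia.
have zr i : r x <= r (z i) <= r y.
  have -> : r x = r (nth x s (index x s)) by rewrite nth_index.
  have -> : r y = r (nth x s (index y s)) by rewrite nth_index.
  by rewrite !r_nth ?leq_addr // (leq_ltn_trans (zs i) ys).
have z_inj : injective z.
  move=> i j /eqP; rewrite nth_uniq ?(leq_ltn_trans (zs _) ys) //.
  by rewrite eqn_add2l => /eqP /val_inj.
(* The labels of the [z i] lie in an interval of length less than 1, so these vertices form a clique
   and get distinct colours. *)
have cz_inj : injective (c \o z).
  move=> i j /= cij; apply/eqP; rewrite -(inj_eq z_inj).
  apply: contraPT cij => zij; apply/eqP/cP/rP => //.
  have := zr i; have := zr j; move: rxy; rewrite !ltr_norml; lra.
have := leq_card _ cz_inj; rewrite !card_ord; lia.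
Qed.

Theorem theorem1p3 (R : realType) :
  exists c : R, forall G : sgraph, unit_interval R G ->
    (chromatic_number G)%:R / 3%:R <= (robust_chromatic_number G)%:R :> R /\
    (robust_chromatic_number G)%:R <= (chromatic_number G)%:R / 3%:R + c.
Proof.
(* The constant comes from [(k + 2) / 3 + 1 <= (k + 6) / 3 = k / 3 + 2]. *)
exists 2%:R => G /unit_interval_bandwidth[s sP band]; split.
  rewrite ler_pdivrMr ?ltr0n // -natrM ler_nat mulnC.
  exact: robust_chromatic_number_ge.
have := robust_chromatic_number_bandwidth _ _ _ sP band.
set k := chromatic_number G; set m := robust_chromatic_number G => mk.
have : (m * 3)%:R <= (k + 6)%:R :> R by rewrite ler_nat; lia.
rewrite natrM natrD; lra.
Qed.
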